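(* Let $p$ be a prime and let $q\in\mathbb{C}_p$ with $|1-q|_p<p^{-1/(p-1)}$. For every integer $n\ge0$, every positive integer $k$ and every $x\in\mathbb{Z}_p$, $$\beta_{n,q}^{(-k)}(x)=\frac{1}{(1-q)^n}\sum_{i=0}^{n}(-1)^i\binom{i+k}{k}_q\,\frac{\binom{n+k}{n-i}}{\binom{n+k}{k}}\,\frac{[k]_q!}{k!}\,q^{ix}.$$
   Context: For $x\in\mathbb{Z}_p$ write $q^x=\exp(x\log q)$ and $[x]_q=\frac{1-q^x}{1-q}$. For integers $n\ge k\ge 0$ put $[n]_q!=[n]_q[n-1]_q\cdots[1]_q$ (with $[0]_q!=1$) and $\binom{n}{k}_q=\frac{[n]_q!}{[k]_q![n-k]_q!}$; $\binom{n}{k}$ is the ordinary binomial coefficient. The $q$-Volkenborn integral of a uniformly differentiable $f:\mathbb{Z}_p\to\mathbb{C}_p$ is $\int_{\mathbb{Z}_p}f(x)\,d\mu_q(x)=\lim_{N\to\infty}\frac{1}{[p^N]_q}\sum_{x=0}^{p^N-1}f(x)q^x$. For positive integers $k$ and integers $n\ge0$ define $$\beta_{n,q}^{(-k)}(x)=\frac{1}{(1-q)^n}\sum_{i=0}^{n}\frac{(-1)^i\binom{n}{i}q^{ix}}{\int_{\mathbb{Z}_p}\cdots\int_{\mathbb{Z}_p}q^{\sum_{l=1}^{k}(k-l+i)x_l}\,d\mu_q(x_1)\cdots d\mu_q(x_k)}.$$ *)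

(* Defs.v *)
From HB Require Import structures.
From mathcomp Require Import all_boot all_order all_algebra.
From mathcomp Require Import all_classical all_reals all_analysis.

Set Implicit Arguments.
Unset Strict Implicit.
Unset Printing Implicit Defensive.

Import Order.TTheory GRing.Theory Num.Theory.

Local Open Scope classical_set_scope.
Local Open Scope ring_scope.

(* [normedZmodType] cannot carry a p-adic absolute value, because it imposes
   `|x *+ n| = `|x| *+ n; hence a dedicated structure, for which the uniform
   structure is that of the distance |x - y|. *)
HB.mixin Record UniformField_isValued (R : realType) C
    & GRing.Field C & Uniform C := {
  vabs : C -> R ;
  vabs_ge0 : forall x : C, 0 <= vabs x ;
  vabs_eq0 : forall x : C, vabs x = 0 <-> x = 0 ;
  vabsM : forall x y : C, vabs (x * y) = vabs x * vabs y ;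
  vabs_ultra : forall x y : C, vabs (x + y) <= Num.max (vabs x) (vabs y) ;
  entourage_vabs :
    @entourage C = entourage_ (fun (x : C) e => [set y | vabs (x - y) < e])
}.

#[short(type="valuedFieldType")]
HB.structure Definition ValuedField (R : realType) :=
  {C of GRing.Field C & Uniform C & UniformField_isValued R C}.

(* The library's [lim] requires a pointed type; 0 is the value for divergent
   sequences. *)
Definition vlim (R : realType) (C : valuedFieldType R) (u : nat -> C) : C :=
  xget 0 [set l | u @ \oo --> l].

(* When [is_Cp p C] holds, the next three sets are Q_p (the completion of Q,
   realised as its closure in C, which is complete), Z_p, and the algebraic
   closure of Q_p. *)
Definition padicQ (R : realType) (C : valuedFieldType R) : set C :=
  closure (range (@ratr C)).

Definition padicZ (R : realType) (C : valuedFieldType R) : set C :=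
  [set x | padicQ x /\ vabs x <= 1].

Definition padicQbar (R : realType) (C : valuedFieldType R) : set C :=
  [set x | exists P : {poly C}, [/\ P != 0, forall i, padicQ P`_i & root P x]].

(* C is the completion of an algebraic closure of Q_p, with the absolute value
   normalised by |p| = 1/p; this determines C up to isometric isomorphism.
   An ultrametric absolute value with |p| = 1/p is the p-adic one on Q. *)
Record is_Cp (p : nat) (R : realType) (C : valuedFieldType R) : Prop :=
  IsCp {
  vabs_p : vabs (p%:R : C) = p%:R^-1 ;
  Cp_complete : forall F : set_system C, ProperFilter F -> cauchy F ->
    exists l : C, F --> l ;
  Qpbar_closed : forall P : {poly C}, (forall i, padicQbar P`_i) -> size P != 1%N ->
    exists2 x, padicQbar x & root P x ;
  Qpbar_dense : dense (@padicQbar R C)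
}.

Definition padic_exp (R : realType) (C : valuedFieldType R) (y : C) : C :=
  vlim (series (fun n => y ^+ n / n`!%:R)).

Definition padic_log (R : realType) (C : valuedFieldType R) (z : C) : C :=
  vlim (series (fun n => (-1) ^+ n * (z - 1) ^+ n.+1 / n.+1%:R)).

Definition qpow (R : realType) (C : valuedFieldType R) (q x : C) : C :=
  padic_exp (x * padic_log q).

(* [x]_q; division by zero gives [x]_1 = 0. *)
Definition qnum (R : realType) (C : valuedFieldType R) (q x : C) : C :=
  (1 - qpow q x) / (1 - q).

Definition qfact (R : realType) (C : valuedFieldType R) (q : C)
    (n : nat) : C :=
  \prod_(j < n) qnum q j.+1%:R.

Definition qbinom (R : realType) (C : valuedFieldType R) (q : C)
    (n k : nat) : C :=
  qfact q n / (qfact q k * qfact q (n - k)).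

(* Functions on Z_p are represented by functions on C: the integral only
   evaluates them at natural numbers. *)
Definition qVolkenborn (p : nat) (R : realType) (C : valuedFieldType R)
    (q : C) (f : C -> C) : C :=
  vlim (fun N => (qnum q (p ^ N)%:R)^-1 *
    \sum_(0 <= x < p ^ N) f x%:R * qpow q x%:R).

(* The first component of the tuple is the innermost variable. *)
Fixpoint qVolkenborn_iter (p : nat) (R : realType)
    (C : valuedFieldType R) (q : C) (k : nat) :
    (k.-tuple C -> C) -> C :=
  match k with
  | 0 => fun F => F [tuple]
  | k'.+1 => fun F => qVolkenborn_iter p q
      (fun t : k'.-tuple C => qVolkenborn p q (fun y => F [tuple of y :: t]))
  end.

(* beta_{n,q}^{(-k)}(x).  Tuples are indexed from 0, so the weight k - l + i of
   the l-th variable becomes k - l.+1 + i. *)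
Definition beta_neg (p : nat) (R : realType) (C : valuedFieldType R)
    (q : C) (k n : nat) (x : C) : C :=
  ((1 - q) ^+ n)^-1 *
  \sum_(i < n.+1)
     ((-1) ^+ i * 'C(n, i)%:R * qpow q (i%:R * x)) /
     qVolkenborn_iter p q (fun y : k.-tuple C =>
       qpow q (\sum_(l < k) (k - l.+1 + i)%:R * tnth y l)).

(* Main.v *)
(* On the disc |y| < p^(-1/(p-1)), which contains log q, the p-adic exponential
   is a homomorphism with |exp y - 1| = |y|.  Hence q^n = Q^n for n natural,
   where Q = exp(log q); the identity Q = q plays no role.  Since Q^(p^N) tends
   to 1, summing geometric progressions gives
   int q^(mx) d mu_q(x) = (m+1)/[m+1]_q, so that the iterated integral is
   prod_(1 <= j <= k) (i+j)/[i+j]_q, and the two sides agree term by term.  If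
   q = 1, both sides are 0 by the conventions on division by zero. *)
Require Import Defs.
From HB Require Import structures.
From mathcomp Require Import all_boot all_order all_algebra.
From mathcomp Require Import all_classical all_reals all_analysis.
From mathcomp Require Import ring lra zify.

Set Implicit Arguments.
Unset Strict Implicit.
Unset Printing Implicit Defensive.

Import Order.TTheory GRing.Theory Num.Theory.

Local Open Scope classical_set_scope.
Local Open Scope ring_scope.

(** * Ultrametric absolute values and limits *)

Section ValuedField.
Variables (R : realType) (C : valuedFieldType R).
Implicit Types (x y z l : C) (u v : nat -> C) (e : R).

Lemma vabs0 : vabs (0 : C) = 0.
Proof. exact/vabs_eq0. Qed.

Lemma vabs_gt0 x : (0 < vabs x) = (x != 0).
Proof.
rewrite lt_neqAle vabs_ge0 andbT eq_sym; congr (~~ _).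
by apply/eqP/eqP => /vabs_eq0.
Qed.

Lemma vabs1 : vabs (1 : C) = 1.
Proof.
have h : vabs (1 : C) != 0 by rewrite gt_eqF // vabs_gt0 oner_eq0.
by apply: (mulfI h); rewrite -vabsM !mulr1.
Qed.

Lemma vabsN x : vabs (- x) = vabs x.
Proof.
rewrite -mulN1r vabsM; suff -> : vabs (-1 : C) = 1 by rewrite mul1r.
have /eqP : vabs (-1 : C) ^+ 2 = 1 by rewrite expr2 -vabsM mulrNN mulr1 vabs1.
rewrite sqrf_eq1 => /orP[/eqP //|/eqP h].
by have := vabs_ge0 (-1 : C); rewrite h; lra.
Qed.

Lemma vabsBC x y : vabs (x - y) = vabs (y - x).
Proof. by rewrite -vabsN opprB. Qed.

Lemma vabsX x n : vabs (x ^+ n) = vabs x ^+ n.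
Proof. by elim: n => [|n ih]; rewrite ?expr0 ?vabs1 // !exprS vabsM ih. Qed.

Lemma vabsV x : vabs x^-1 = (vabs x)^-1.
Proof.
have [->|x0] := eqVneq x 0; first by rewrite invr0 vabs0 invr0.
have h : vabs x != 0 by rewrite gt_eqF // vabs_gt0.
by apply: (mulfI h); rewrite -vabsM !divff // vabs1.
Qed.

Lemma vabsD_le x y e : vabs x <= e -> vabs y <= e -> vabs (x + y) <= e.
Proof. by move=> hx hy; rewrite (le_trans (vabs_ultra x y))// ge_max hx. Qed.

Lemma vabsD_lt x y e : vabs x < e -> vabs y < e -> vabs (x + y) < e.
Proof. by move=> hx hy; rewrite (le_lt_trans (vabs_ultra x y))// gt_max hx. Qed.

Lemma vabs_sum_le I (s : seq I) (P : pred I) (F : I -> C) e : 0 <= e ->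
  (forall i, P i -> vabs (F i) <= e) -> vabs (\sum_(i <- s | P i) F i) <= e.
Proof.
move=> e0 h; apply: (big_ind (fun x => vabs x <= e)) => //.
  by rewrite vabs0.
by move=> *; exact: vabsD_le.
Qed.

Lemma vabs_sum_lt I (s : seq I) (P : pred I) (F : I -> C) e : 0 < e ->
  (forall i, P i -> vabs (F i) < e) -> vabs (\sum_(i <- s | P i) F i) < e.
Proof.
move=> e0 h; apply: (big_ind (fun x => vabs x < e)) => //.
  by rewrite vabs0.
by move=> *; exact: vabsD_lt.
Qed.

Lemma vabs_nat_le1 n : vabs (n%:R : C) <= 1.
Proof.
elim: n => [|n ih]; first by rewrite vabs0.
by rewrite -addn1 natrD; apply: vabsD_le; rewrite ?vabs1.
Qed.

Lemma cvg_vabsP u l : u @ \oo --> l <->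
  forall e, 0 < e -> \forall n \near \oo, vabs (l - u n) < e.
Proof.
split.
  move=> /cvg_entourageP h e e0.
  apply: (h [set xy | vabs (xy.1 - xy.2) < e]).
  by rewrite entourage_vabs; exists e.
move=> h; apply/cvg_entourageP => A; rewrite entourage_vabs => -[e /= e0 eA].
have := h _ e0; apply: filterS => n hn; exact: eA.
Qed.

Lemma vabs_lim_le u l x e : u @ \oo --> l ->
  (\forall n \near \oo, vabs (u n - x) <= e) -> vabs (l - x) <= e.
Proof.
move=> /cvg_vabsP ul hu; rewrite leNgt; apply/negP => lt_e.
have lx0 : 0 < vabs (l - x).
  near \oo => n; rewrite (le_lt_trans _ lt_e)// (le_trans (vabs_ge0 (u n - x)))//.
  by near: n.
(* The ultrametric inequality is applied with |l - x| itself as strict bound: both l - [u n] and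
   [u n] - x are eventually smaller. *)
have : \forall n \near \oo, vabs (l - x) < vabs (l - x).
  near=> n.
  rewrite -{1}[l](subrK (u n)) -addrA; apply: vabsD_lt.
    by near: n; exact: ul.
  by apply: le_lt_trans lt_e; near: n.
by move=> /filter_ex[n]; rewrite ltxx.
Unshelve. all: by end_near. Qed.

Lemma vlimE u l : u @ \oo --> l -> vlim u = l.
Proof.
move=> ul; apply: xget_unique => // l' ul'.
apply/eqP; rewrite -subr_eq0; apply/eqP/vabs_eq0/eqP.
rewrite eq_le vabs_ge0 andbT; apply/ler_addgt0Pr => e e0; rewrite add0r.
apply: (vabs_lim_le ul'); move/cvg_vabsP : ul => /(_ e e0).
by apply: filterS => n; rewrite vabsBC => /ltW.
Qed.

Lemma cvg_vabs_cst x : (fun=> x) @ \oo --> x.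
Proof. by apply/cvg_vabsP => e e0; near=> n; rewrite subrr vabs0.
Unshelve. all: by end_near. Qed.

Lemma vlim_cst x : vlim (fun=> x) = x.
Proof. exact/vlimE/cvg_vabs_cst. Qed.

(** A strict bound survives the limit because l is within e of some [u n], which is itself smaller
    than e; for a divergent sequence [vlim] takes its default value 0. *)
Lemma vabs_vlim_lt u e : 0 < e -> (forall n, vabs (u n) < e) ->
  vabs (vlim u) < e.
Proof.
move=> e0 hu; have [[l ul]|no] := pselect (exists l, u @ \oo --> l).
  rewrite (vlimE ul); move/cvg_vabsP : ul => /(_ e e0) /filter_ex[n hn].
  by rewrite -(subrK (u n) l); apply: vabsD_lt.
rewrite /vlim xgetPN ?vabs0// => l ul; apply: no; by exists l.
Qed.

Lemma cvg_vabsM u v l m :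
  (forall n, vabs (v n) <= 1) -> vabs l <= 1 ->
  u @ \oo --> l -> v @ \oo --> m -> (fun n => u n * v n) @ \oo --> l * m.
Proof.
move=> v1 l1 /cvg_vabsP ul /cvg_vabsP vm; apply/cvg_vabsP => e e0; near=> n.
have -> : l * m - u n * v n = l * (m - v n) + (l - u n) * v n by ring.
apply: vabsD_lt; rewrite vabsM.
  by rewrite (@le_lt_trans _ _ (vabs (m - v n)))// ?ler_piMl ?vabs_ge0//; near: n; exact: vm.
by rewrite (@le_lt_trans _ _ (vabs (l - u n)))// ?ler_piMr ?vabs_ge0//; near: n; exact: ul.
Unshelve. all: by end_near. Qed.

Lemma cvg_vabsMl a u l :
  u @ \oo --> l -> (fun n => a * u n) @ \oo --> a * l.
Proof.
have [->|a0] := eqVneq a 0.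
  move=> _; rewrite mul0r; under eq_fun do rewrite mul0r; exact: cvg_vabs_cst.
move=> /cvg_vabsP ul; apply/cvg_vabsP => e e0; near=> n.
rewrite -mulrBr vabsM -ltr_pdivlMl ?vabs_gt0//; near: n; apply: ul.
by rewrite mulr_gt0// invr_gt0 vabs_gt0.
Unshelve. all: by end_near. Qed.

Lemma near_expr_lt (z e : R) : 0 <= z < 1 -> 0 < e ->
  \forall n \near \oo, z ^+ n < e.
Proof.
move=> /andP[z0 z1] e0.
have /cvgr0_norm_lt/(_ e e0) : (GRing.exp z : R ^nat) @ \oo --> 0.
  by apply: cvg_expr; rewrite ger0_norm.
by apply: filterS => n; rewrite ger0_norm// exprn_ge0.
Qed.

End ValuedField.

(** * Convergence of series; p-adic size of integers, factorials and logarithms *)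

Section Cp.
Variables (p : nat) (R : realType) (C : valuedFieldType R).
Hypotheses (p_pr : prime p) (hC : is_Cp p C).
Implicit Types (x y z l : C) (u v : nat -> C) (e : R).

(** A block of terms is no larger than its largest term, so the partial sums are Cauchy as soon as
    the terms tend to 0. *)
Lemma vabs_series_cvg u :
  (forall e, 0 < e -> \forall n \near \oo, vabs (u n) < e) ->
  exists l, series u @ \oo --> l.
Proof.
move=> hu; apply: (Cp_complete hC) => A; rewrite entourage_vabs.
move=> -[e /= e0 eA]; have [N _ hN] := hu e e0.
have far n : (N <= n)%N -> vabs (series u n - series u N) < e.
  move=> Nn; rewrite sub_series_geq// big_nat_cond; apply: vabs_sum_lt => // i.
  by rewrite andbT => /andP[Ni _]; exact: hN.
have hnear : (series u @ \oo) [set y | vabs (y - series u N) < e].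
  by exists N => // n /= Nn; exact: far.
exists ([set y | vabs (y - series u N) < e],
        [set y | vabs (y - series u N) < e]) => // -[y z] /= [hy hz].
apply: eA => /=; rewrite -(subrK (series u N) y) -addrA.
by apply: vabsD_lt => //; rewrite vabsBC.
Qed.

(** If |n| < 1, a Bezout relation a p - b n = 1 would give |1| < 1. *)
Lemma vabs_coprime n : coprime p n -> vabs (n%:R : C) = 1.
Proof.
move=> cpn; apply/eqP; rewrite eq_le vabs_nat_le1/= leNgt; apply/negP => n1.
have [a b ab _] := egcdnP n (prime_gt0 p_pr).
have : vabs ((a * p)%:R - (b * n)%:R : C) < 1.
  apply: vabsD_lt; rewrite ?vabsN natrM vabsM.
    rewrite (vabs_p hC) (@le_lt_trans _ _ p%:R^-1)//.
      by rewrite ler_piMl ?invr_ge0 ?vabs_nat_le1.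
    by rewrite invf_lt1 ?ltr1n ?ltr0n ?prime_gt1 ?prime_gt0.
  by rewrite (le_lt_trans _ n1)// ler_piMl ?vabs_ge0 ?vabs_nat_le1.
by rewrite ab (eqP cpn) natrD addrAC subrr add0r vabs1 ltxx.
Qed.

Lemma vabs_nat n : (0 < n)%N -> vabs (n%:R : C) = p%:R^-1 ^+ logn p n.
Proof.
move=> n0; have [m cpm {1}->] := pfactor_coprime p_pr n0.
by rewrite natrM vabsM vabs_coprime// mul1r natrX vabsX (vabs_p hC).
Qed.

Lemma natr_Cp_neq0 n : (0 < n)%N -> (n%:R : C) != 0.
Proof.
move=> n0; rewrite -vabs_gt0 vabs_nat// exprn_gt0// invr_gt0 ltr0n.
exact: prime_gt0.
Qed.

(** Legendre's formula for the valuation of a factorial, followed by a telescoping estimate. *)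
Lemma logn_fact_lt n : (p.-1 * logn p n.+1`! <= n)%N.
Proof.
rewrite logn_fact//.
(* Telescoping: p times the quotient by p^(K+1) is at most the quotient by p^K. *)
have tel K : (p.-1 * \sum_(1 <= k < K.+1) n.+1 %/ p ^ k + n.+1 %/ p ^ K <= n.+1)%N.
  elim: K => [|K ih]; first by rewrite big_geq// muln0 expn0 divn1.
  rewrite big_nat_recr//= mulnDr -addnA (leq_trans _ ih)// leq_add2l.
  rewrite addnC -mulSn prednK ?prime_gt0// expnSr divnMA mulnC.
  exact: leq_trunc_div.
elim: (X in (\sum_(_ <= _ < X.+1) _)%N) => [|K ih].
  by rewrite big_geq// muln0.
(* A positive last quotient makes [tel] strict, which gains the missing 1; a zero one is dropped
   from the sum. *)
have := tel K.+1; case E : (_ %/ p ^ K.+1)%N => [|d]; last by lia.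
by move=> _; rewrite big_nat_recr//= E addn0.
Qed.

(* The radius of convergence of the p-adic exponential. *)
Let r : R := p%:R `^ (- (p.-1)%:R^-1).

Lemma radius_gt0 : 0 < r.
Proof. by rewrite powR_gt0// ltr0n prime_gt0. Qed.

Lemma radius_expE : r ^+ p.-1 = p%:R^-1.
Proof.
have p1 : (0 < p.-1)%N by have := prime_gt1 p_pr; lia.
rewrite -powR_mulrn ?powR_ge0// -powRrM mulNr mulVf ?pnatr_eq0 -?lt0n//.
by rewrite powR_inv1.
Qed.

Lemma radius_le1 : r <= 1.
Proof.
rewrite leNgt; apply/negP => r1.
have : 1 <= r ^+ p.-1 by rewrite exprn_ege1// ltW.
by rewrite radius_expE invf_ge1 ?ltr0n ?prime_gt0// lern1 leqNgt prime_gt1.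
Qed.

(** Since r^(p-1) = 1/p, the left exponent only has to dominate p - 1 times the valuation. This
    bound controls the denominators of both the logarithm and the exponential. *)
Lemma vabs_fact_ge n : r ^+ n <= vabs (n.+1`!%:R : C).
Proof.
rewrite vabs_nat ?fact_gt0// -radius_expE -exprM.
by apply: ler_wiXn2l; rewrite ?radius_le1 ?(ltW radius_gt0)// logn_fact_lt.
Qed.

(** Each term is at most |z - 1|, because |z - 1|^n <= r^n <= |(n+1)!| <= |n+1|. *)
Lemma vabs_padic_log_lt z : vabs (1 - z) < r -> vabs (padic_log z) < r.
Proof.
rewrite vabsBC => zr; apply: (vabs_vlim_lt radius_gt0) => N.
rewrite /series /=; apply: (vabs_sum_lt _ radius_gt0) => n _.
rewrite !vabsM vabsV !vabsX vabsN vabs1 expr1n mul1r.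
have n0 : 0 < vabs (n.+1%:R : C) by rewrite vabs_gt0 natr_Cp_neq0.
rewrite ltr_pdivrMr// exprS.
have /le_lt_trans : vabs (z - 1) * vabs (z - 1) ^+ n
    <= vabs (z - 1) * vabs (n.+1%:R : C).
  rewrite ler_wpM2l ?vabs_ge0// (@le_trans _ _ (r ^+ n))//.
    by rewrite lerXn2r ?nnegrE ?vabs_ge0 ?(ltW radius_gt0) ?(ltW zr).
  rewrite (le_trans (vabs_fact_ge n))// factS natrM vabsM.
  by rewrite ler_piMr ?vabs_ge0 ?vabs_nat_le1.
by apply; rewrite ltr_pM2r.
Qed.

(** * The p-adic exponential on its disc of convergence *)

Let expt y n : C := y ^+ n / n`!%:R.

(** One factor |y| is set aside, and the n others are absorbed by r^n <= |(n+1)!|. The factor kept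
    allows comparison with the linear term. *)
Lemma vabs_exptS y (rho : R) n : 0 <= rho -> vabs y <= rho * r ->
  vabs (expt y n.+1) <= vabs y * rho ^+ n.
Proof.
move=> rho0 yr; rewrite /expt vabsM vabsV vabsX.
rewrite ler_pdivrMr ?vabs_gt0 ?natr_Cp_neq0 ?fact_gt0// exprS -mulrA.
rewrite ler_wpM2l ?vabs_ge0// (@le_trans _ _ ((rho * r) ^+ n))//.
  by rewrite lerXn2r ?nnegrE ?vabs_ge0// mulr_ge0// ltW// radius_gt0.
by rewrite exprMn ler_wpM2l ?exprn_ge0// vabs_fact_ge.
Qed.

Lemma vabs_expt y (rho : R) n : 0 <= rho -> vabs y <= rho * r ->
  vabs (expt y n) <= rho ^+ n.
Proof.
move=> rho0 yr; case: n => [|n].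
  by rewrite /expt !expr0 fact0 divr1 vabs1.
rewrite (le_trans (vabs_exptS n rho0 yr))// exprS ler_wpM2r ?exprn_ge0//.
by rewrite (le_trans yr)// ler_piMr// radius_le1.
Qed.

(** Supplies the ratio [rho] of a geometric majorant of the exponential series. *)
Lemma vabs_scaled y : vabs y < r ->
  exists2 rho : R, 0 <= rho < 1 & vabs y <= rho * r.
Proof.
move=> yr; have r0 := radius_gt0; exists (vabs y / r).
  by rewrite divr_ge0 ?vabs_ge0 ?(ltW r0)//= ltr_pdivrMr// mul1r.
by rewrite divfK// gt_eqF.
Qed.

Lemma padic_exp_cvg y : vabs y < r -> series (expt y) @ \oo --> padic_exp y.
Proof.
move=> /vabs_scaled[rho /[dup] /andP[rho0 _] rho1 yr].
have [l hl] : exists l, series (expt y) @ \oo --> l.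
  apply: vabs_series_cvg => e e0; have := near_expr_lt rho1 e0.
  by apply: filterS => n; apply: le_lt_trans; exact: vabs_expt.
by rewrite /padic_exp (vlimE hl).
Qed.

Lemma vabs_series_expt_le1 y N : vabs y < r -> vabs (series (expt y) N) <= 1.
Proof.
move=> /vabs_scaled[rho /andP[rho0 rho1] yr].
rewrite /series/= vabs_sum_le// => i _.
by rewrite (le_trans (vabs_expt i rho0 yr))// exprn_ile1// ltW.
Qed.

Lemma vabs_padic_exp_le1 y : vabs y < r -> vabs (padic_exp y) <= 1.
Proof.
move=> yr; rewrite -[padic_exp y]subr0; apply: (vabs_lim_le (padic_exp_cvg yr)).
by near=> n; rewrite subr0; exact: vabs_series_expt_le1.
Unshelve. all: by end_near. Qed.

Lemma vabs_padic_expB1 y : vabs y < r -> vabs (padic_exp y - 1) = vabs y.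
Proof.
move=> yr; have [rho /andP[rho0 rho1] yrho] := vabs_scaled yr.
have [->|y0] := eqVneq y 0.
  suff -> : padic_exp (0 : C) = 1 by rewrite subrr.
  apply: vlimE; apply/cvg_vabsP => e e0; exists 1%N => // -[//|n] _.
  rewrite /series/= big_nat_recl//= expr0 fact0 divr1 big1.
    by rewrite addr0 subrr vabs0.
  by move=> i _; rewrite expr0n mul0r.
have lt_y : rho * vabs y < vabs y by rewrite gtr_pMl// vabs_gt0.
(* All terms of degree at least 2 are bounded by [rho] |y|, strictly below the linear term, which
   therefore dominates. *)
have exp2 : vabs (padic_exp y - (1 + y)) <= rho * vabs y.
  apply: (vabs_lim_le (padic_exp_cvg yr)); exists 2%N => // -[|[|n]] // _.
  rewrite /series/= 2?big_nat_recl//= /expt expr0 expr1 fact0 !divr1 addrA.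
  rewrite [_ - _]addrC addKr; apply: vabs_sum_le => [|i _].
    by rewrite mulr_ge0 ?vabs_ge0.
  rewrite (le_trans (vabs_exptS _ rho0 yrho))// exprS mulrC.
  by rewrite ler_wpM2r ?vabs_ge0// ler_piMr// exprn_ile1// ltW.
apply/eqP; rewrite eq_le; apply/andP; split.
  have -> : padic_exp y - 1 = (padic_exp y - (1 + y)) + y by ring.
  by apply: vabsD_le => //; rewrite (le_trans exp2)// ltW.
(* Otherwise y would be a difference of two elements smaller than |y|. *)
rewrite leNgt; apply/negP => h.
have : vabs ((padic_exp y - 1) - (padic_exp y - (1 + y))) < vabs y.
  by apply: vabsD_lt => //; rewrite vabsN (le_lt_trans exp2).
suff -> : (padic_exp y - 1) - (padic_exp y - (1 + y)) = y by rewrite ltxx.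
by ring.
Qed.

(** The diagonals of a Cauchy product, taken below N, fill the triangle i + j < N. *)
Lemma sum_triangle (V : nmodType) (G : nat -> nat -> V) N :
  \sum_(n < N) \sum_(i < n.+1) G (n - i)%N i =
  \sum_(i < N) \sum_(j < N | (i + j < N)%N) G j i.
Proof.
transitivity (\sum_(n < N) \sum_(i < N | (i <= n)%N) G (n - i)%N i).
  by apply: eq_bigr => n _; rewrite (big_ord_widen N (fun i => G (n - i)%N i)).
rewrite (exchange_big_dep predT)//=; apply: eq_bigr => i _.
rewrite -(big_mkord (fun n => (i <= n)%N) (fun n => G (n - i)%N i)).
transitivity (\sum_(i <= n < N) G (n - i)%N i).
  by rewrite (big_nat_widenl i 0%N).
rewrite -[X in \sum_(X <= _ < _) _]add0n big_addn big_mkord.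
rewrite (big_ord_widen_cond N predT (fun j => G (j + i - i)%N i)) ?leq_subr//=.
by apply: eq_big => [j|j _]; rewrite ?addnK// ltn_subRL.
Qed.

Lemma exptD a b n : expt (a + b) n = \sum_(i < n.+1) expt a (n - i) * expt b i.
Proof.
rewrite /expt exprDn mulr_suml; apply: eq_bigr => i _.
have hi : (i <= n)%N by rewrite -ltnS.
have f0 m : (m`!%:R : C) != 0 by rewrite natr_Cp_neq0// fact_gt0.
have := congr1 (fun m => m%:R : C) (bin_fact hi); rewrite /= !natrM => e.
rewrite -mulr_natr.
have -> : 'C(n, i)%:R = n`!%:R / (i`!%:R * (n - i)`!%:R) :> C.
  by apply: (mulIf (mulf_neq0 (f0 i) (f0 (n - i)%N))); rewrite divfK// mulf_neq0.
field.
by rewrite !f0.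
Qed.
(** The product of two partial sums runs over a square, the partial sum for a + b over the triangle
    below its antidiagonal; the rest of the square tends to 0. *)
Lemma padic_expD (a b : C) : vabs a < r -> vabs b < r ->
  padic_exp (a + b) = padic_exp a * padic_exp b.
Proof.
move=> ar br; have abr := vabsD_lt ar br.
have [rho /[dup] /andP[rho0 rho1] rho01 [arho brho]] :
    exists2 rho : R, 0 <= rho < 1 & vabs a <= rho * r /\ vabs b <= rho * r.
  have [[s /andP[s0 s1] hs] [t /andP[t0 t1] ht]] :=
    (vabs_scaled ar, vabs_scaled br).
  exists (Num.max s t); first by rewrite le_max s0 gt_max s1.
  split; [apply: (le_trans hs)|apply: (le_trans ht)];
    by rewrite ler_wpM2r ?(ltW radius_gt0)// le_max lexx ?orbT.
apply: vlimE; apply/cvg_vabsP => e e0.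
have /cvg_vabsP/(_ _ e0) cvgM := cvg_vabsM
  (fun n => vabs_series_expt_le1 n br) (vabs_padic_exp_le1 ar)
  (padic_exp_cvg ar) (padic_exp_cvg br).
near=> N.
rewrite -(subrK (series (expt a) N * series (expt b) N) (_ * _)) -addrA.
apply: vabsD_lt; first by near: N.
have -> : series (expt a) N * series (expt b) N =
    \sum_(i < N) \sum_(j < N) expt a j * expt b i.
  rewrite /series/= !big_mkord mulr_sumr; apply: eq_bigr => i _.
  by rewrite mulr_suml.
have -> : series (expt (a + b)) N =
    \sum_(i < N) \sum_(j < N | (i + j < N)%N) expt a j * expt b i.
  rewrite -(sum_triangle (fun j i => expt a j * expt b i)) /series/= big_mkord.
  by apply: eq_bigr => n _; exact: exptD.
rewrite -sumrB; apply: (vabs_sum_lt _ e0) => i _.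
rewrite (bigID (fun j : 'I_N => (i + j < N)%N))/= addrAC subrr add0r.
apply: (vabs_sum_lt _ e0) => j; rewrite -leqNgt => ijN.
(* Outside the triangle i + j >= N, so each product of terms is at most [rho]^N. *)
apply: (@le_lt_trans _ _ (rho ^+ N)); last by near: N; exact: near_expr_lt.
rewrite vabsM (@le_trans _ _ (rho ^+ j * rho ^+ i))//.
  by rewrite ler_pM ?vabs_ge0// vabs_expt.
by rewrite -exprD addnC; apply: ler_wiXn2l => //; exact: ltW.
Unshelve. all: by end_near. Qed.

Lemma vabs_mul_nat_lt n y : vabs y < r -> vabs (n%:R * y) < r.
Proof.
apply: le_lt_trans; rewrite vabsM ler_piMl ?vabs_ge0//.
exact: vabs_nat_le1.
Qed.

Lemma padic_exp_nat n y : vabs y < r -> padic_exp (n%:R * y) = padic_exp y ^+ n.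
Proof.
move=> yr; elim: n => [|n ih].
  have r0 : vabs (0 : C) < r by rewrite vabs0 radius_gt0.
  apply/eqP; rewrite mul0r expr0 -subr_eq0; apply/eqP/vabs_eq0.
  by rewrite vabs_padic_expB1// vabs0.
rewrite -addn1 natrD mulrDl mul1r padic_expD ?vabs_mul_nat_lt//.
by rewrite ih addn1 exprSr.
Qed.


(** * The q-numbers and the q-Volkenborn integrals *)

Variable q : C.
Hypothesis hq : vabs (1 - q) < r.
Let Q := padic_exp (padic_log q).
Local Notation integral := (qVolkenborn p q).

Lemma qpow_nat n : qpow q n%:R = Q ^+ n.
Proof. by rewrite /qpow padic_exp_nat// vabs_padic_log_lt. Qed.

Lemma vabs_qpow_nat n : vabs (Q ^+ n - 1) = vabs (n%:R * padic_log q).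
Proof.
have Lr := vabs_padic_log_lt hq.
by rewrite -padic_exp_nat// vabs_padic_expB1// vabs_mul_nat_lt.
Qed.

Lemma qnum_nat n : qnum q n%:R = (1 - Q ^+ n) / (1 - q).
Proof. by rewrite /qnum qpow_nat. Qed.

(** As |Q^n - 1| = |n log q| and n is nonzero in C, the [n]_q with n > 0 vanish all together or not
    at all. This is the case distinction of the final proof. *)
Lemma qnum_nat_eq0 n : (0 < n)%N ->
  (qnum q n%:R == 0) = (q == 1) || (padic_log q == 0).
Proof.
move=> n0; rewrite qnum_nat mulf_eq0 invr_eq0 orbC !(subr_eq0 1) !(eq_sym 1).
congr (_ || _); rewrite -subr_eq0.
have: (vabs (Q ^+ n - 1) == 0) = (vabs (n%:R * padic_log q) == 0).
  by rewrite vabs_qpow_nat.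
have v0 x : (vabs x == 0) = (x == 0 :> C).
  by apply/eqP/eqP => /vabs_eq0.
by rewrite !v0 mulf_eq0 (negbTE (natr_Cp_neq0 n0)).
Qed.

(* [qVolkenborn] divides by [p^N]_q, and division by zero gives zero. *)
Lemma qVolkenborn_degenerate f :
  (forall n, (0 < n)%N -> qnum q n%:R = 0) -> integral f = 0.
Proof.
move=> q0; rewrite /qVolkenborn -[RHS]vlim_cst; congr vlim; apply/funext => N.
by rewrite q0 ?expn_gt0 ?prime_gt0// invr0 mul0r.
Qed.

Lemma qpow_pexp_cvg : (fun N => Q ^+ (p ^ N)) @ \oo --> (1 : C).
Proof.
have Lr := vabs_padic_log_lt hq.
apply/cvg_vabsP => e e0; near=> N.
rewrite vabsBC vabs_qpow_nat natrX vabsM vabsX (vabs_p hC).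
rewrite (@le_lt_trans _ _ (p%:R^-1 ^+ N))//.
  rewrite ler_piMr ?exprn_ge0 ?invr_ge0//.
  by rewrite (le_trans (ltW Lr))// radius_le1.
near: N; apply: near_expr_lt => //; rewrite invr_ge0 ler0n/=.
by rewrite invf_lt1 ?ltr1n ?ltr0n ?prime_gt1 ?prime_gt0.
Unshelve. all: by end_near. Qed.

Lemma vabs_qpow_nat_le1 n : vabs (Q ^+ n) <= 1.
Proof.
rewrite vabsX exprn_ile1 ?vabs_ge0// vabs_padic_exp_le1//.
exact: vabs_padic_log_lt.
Qed.

(* The Riemann sums are multiples of 1 + z + ... + z^m for z = Q^(p^N), which
   tends to 1. *)
Lemma qVolkenborn_expr (c : C) m :
  (forall n, (0 < n)%N -> qnum q n%:R != 0) ->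
  forall f, (forall n : nat, f n%:R = c * Q ^+ (m * n)) ->
  integral f = c * (m.+1%:R / qnum q m.+1%:R).
Proof.
move=> q0 f hf; apply: vlimE.
have q1 : 1 - q != 0.
  by have := q0 1%N isT; rewrite /qnum mulf_eq0 invr_eq0 negb_or => /andP[].
have Q1 n : (0 < n)%N -> 1 - Q ^+ n != 0.
  by move=> /q0; rewrite qnum_nat mulf_eq0 negb_or => /andP[].
have -> : (fun N => (qnum q (p ^ N)%:R)^-1 *
    \sum_(0 <= x < p ^ N) f x%:R * qpow q x%:R) =
  (fun N => (c / qnum q m.+1%:R) * \sum_(i < m.+1) (Q ^+ (p ^ N)) ^+ i).
  apply/funext => N; set P := (p ^ N)%N.
  have P0 : 1 - Q ^+ P != 0 by rewrite Q1// expn_gt0 prime_gt0.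
  have -> : \sum_(0 <= x < P) f x%:R * qpow q x%:R =
      c * ((1 - (Q ^+ m.+1) ^+ P) / (1 - Q ^+ m.+1)).
    rewrite -[1 - _ ^+ P]opprB subrX1 -[Q ^+ m.+1 - 1]opprB !mulNr opprK.
    rewrite mulrAC divff ?Q1// mul1r mulr_sumr big_mkord.
    apply: eq_bigr => i _; rewrite hf qpow_nat -mulrA -exprD -exprM.
    by rewrite mulSn addnC mulrC.
  (* Exchanging the exponents exhibits the factor 1 - Q^P, which cancels against [P]_q. *)
  have -> : (Q ^+ m.+1) ^+ P = (Q ^+ P) ^+ m.+1 by rewrite -!exprM mulnC.
  rewrite -[1 - (_ ^+ P) ^+ _]opprB subrX1 !qnum_nat.
  by field; rewrite q1 P0 Q1.
have -> : c * (m.+1%:R / qnum q m.+1%:R) =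
  c / qnum q m.+1%:R * \sum_(i < m.+1) 1 ^+ i.
  under eq_bigr do rewrite expr1n.
  by rewrite sumr_const card_ord mulrA mulrAC.
apply: cvg_vabsMl.
move/cvg_vabsP : qpow_pexp_cvg => Qcvg; apply/cvg_vabsP => e e0.
have := Qcvg _ e0; apply: filterS => N hN.
rewrite -sumrB; apply: vabs_sum_lt => // i _.
(* For z = Q^(p^N), z - 1 divides z^i - 1 with a cofactor of absolute value at most 1. *)
rewrite expr1n vabsBC subrX1 vabsM (le_lt_trans _ hN)// [leRHS]vabsBC.
rewrite ler_piMr ?vabs_ge0// vabs_sum_le// => j _.
by rewrite -exprM vabs_qpow_nat_le1.
Qed.

(** Induction from the innermost variable: [c] collects the factors already integrated, and
    arbitrary weights [m] allow the shift to the remaining variables. [F] is prescribed only at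
    natural arguments, where the Riemann sums evaluate it. *)
Lemma qVolkenborn_iter_expr k (m : nat -> nat) :
  (forall n, (0 < n)%N -> qnum q n%:R != 0) ->
  forall (F : k.-tuple C -> C) (c : C),
  (forall t : k.-tuple nat, F [tuple of map (fun n => n%:R) t] =
     c * Q ^+ (\sum_(l < k) m l * tnth t l)%N) ->
  qVolkenborn_iter p q F = c * \prod_(l < k) ((m l).+1%:R / qnum q (m l).+1%:R).
Proof.
move=> q0; elim: k m => [|k ih] m F c hF.
  have := hF [tuple]; rewrite !big_ord0 expr0 mulr1 => <- /=.
  by congr F; exact: val_inj.
rewrite /= big_ord_recl mulrA.
under eq_bigr do rewrite lift0.
apply: (ih (fun j => m j.+1)) => t; rewrite mulrAC.
apply: qVolkenborn_expr => // n; rewrite -mulrA -exprD.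
have := hF [tuple of n :: t]; rewrite big_ord_recl.
under eq_bigr do rewrite tnthS; rewrite tnth0 addnC => <-.
by congr F; exact: val_inj.
Qed.

Lemma qVolkenborn_iter_degenerate k (F : k.+1.-tuple C -> C) :
  (forall n, (0 < n)%N -> qnum q n%:R = 0) -> qVolkenborn_iter p q F = 0.
Proof.
move=> q0; elim: k F => [|k ih] F; last exact: ih.
by rewrite /= qVolkenborn_degenerate.
Qed.

Lemma qfact_neq0 n : (forall m, (0 < m)%N -> qnum q m%:R != 0) -> qfact q n != 0.
Proof. by move=> q0; apply/prodf_neq0 => j _; exact: q0. Qed.

Lemma qVolkenborn_iter_qpow k i : (forall m, (0 < m)%N -> qnum q m%:R != 0) ->
  qVolkenborn_iter p q (fun y : k.-tuple C =>
       qpow q (\sum_(l < k) (k - l.+1 + i)%:R * tnth y l)) =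
  (i + k)`!%:R / i`!%:R / (qfact q (i + k) / qfact q i).
Proof.
move=> q0; rewrite (@qVolkenborn_iter_expr k (fun j => k - j.+1 + i)%N q0 _ 1).
  (* The weights decrease from i + k - 1 to i; reversing them gives the last k factors of (i+k)! and
     of its q-analogue. *)
  rewrite mul1r (reindex_inj rev_ord_inj)/=.
  rewrite (eq_bigr (fun j : 'I_k =>
    (i + j).+1%:R / qnum q (i + j).+1%:R)); last first.
    move=> j _; suff -> : (k - (k - j.+1).+1 + i)%N = (i + j)%N by [].
    by have := ltn_ord j; lia.
  rewrite big_split/= prodfV.
  have factE n : n`!%:R = \prod_(j < n) (j.+1%:R : C).
    by rewrite fact_prod big_add1 big_mkord/= natr_prod.
  have i0 : \prod_(j < i) (j.+1%:R : C) != 0.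
    by rewrite -factE natr_Cp_neq0// fact_gt0.
  rewrite !factE /qfact !big_split_ord/=.
  by rewrite ![_ * \prod_(_ < k) _]mulrC !mulfK//; exact: qfact_neq0.
move=> t; rewrite mul1r -qpow_nat natr_sum; congr qpow; apply: eq_bigr => l _.
by rewrite tnth_map natrM.
Qed.

End Cp.

Theorem theorem5 (p : nat) (R : realType) (C : valuedFieldType R)
    (hp : prime p) (hC : is_Cp p C)
    (q : C) (hq : vabs (1 - q) < p%:R `^ (- (p.-1)%:R^-1))
    (n k : nat) (hk : (0 < k)%N) (x : C) (hx : padicZ x) :
  beta_neg p q k n x =
  ((1 - q) ^+ n)^-1 *
  \sum_(i < n.+1)
     (-1) ^+ i * qbinom q (i + k) k *
     ('C(n + k, n - i)%:R / 'C(n + k, k)%:R) *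
     (qfact q k / k`!%:R) *
     qpow q (i%:R * x).
Proof.
rewrite /beta_neg; congr (_ * _); apply: eq_bigr => i _.
(* Either alternative makes every [m]_q with m > 0 vanish. *)
case degen: ((q == 1) || (padic_log q == 0)).
  have q0 m : (0 < m)%N -> qnum q m%:R = 0.
    by move=> m0; apply/eqP; rewrite (qnum_nat_eq0 hp hC hq).
  (* Positivity of [k] provides an integral equal to 0 in the left denominator and the factor [1]_q
     = 0 of [k]_q! on the right. *)
  case: k hk => // k _; rewrite (qVolkenborn_iter_degenerate hp)//.
  by rewrite invr0 mulr0 /qfact big_ord_recl q0// !mul0r mulr0 mul0r.
have q0 m : (0 < m)%N -> qnum q m%:R != 0.
  by move=> m0; rewrite (qnum_nat_eq0 hp hC hq)// degen.
have f0 m : (m`!%:R : C) != 0 by rewrite (natr_Cp_neq0 hp hC)// fact_gt0.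
have binE a b c : (a + b = c)%N -> 'C(c, a)%:R = c`!%:R / (a`!%:R * b`!%:R) :> C.
  move=> <-; have := bin_fact (leq_addr b a); rewrite addKn => <-.
  by rewrite !natrM mulfK// mulf_neq0.
have hi : (i <= n)%N by rewrite -ltnS.
rewrite (qVolkenborn_iter_qpow hp hC hq)// /qbinom addnK.
(* With every binomial written in factorials, both sides reduce to the same quotient. *)
rewrite (binE i (n - i)%N) ?subnKC// (binE (n - i)%N (i + k)%N); last by lia.
rewrite (binE k n) 1?addnC//.
field.
by rewrite !f0 !qfact_neq0.
Qed.
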